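(* For every set $F\in\mathcal{E}$ there is a splitting tree $T\subseteq 2^{<\omega}$ such that for every $n\in\omega$ $$F+\underbrace{[T]+[T]+\dots+[T]}_{n\text{ times}}\in\mathcal{E}.$$
   Context: $\mathcal{E}$ denotes the $\sigma$-ideal of subsets of $2^\omega$ generated by closed null sets, i.e. $E\in\mathcal{E}$ iff $E$ is contained in a countable union of closed subsets of $2^\omega$ of measure zero for the standard product (Haar) probability measure. A tree is a nonempty set $T\subseteq 2^{<\omega}$ closed under initial segments, and $[T]=\{x\in 2^\omega:(\forall n\in\omega)\ x\upharpoonright n\in T\}$. $T$ is a splitting tree if $(\forall\sigma\in T)(\exists N\in\omega)(\forall n>N)(\forall i\in\{0,1\})(\exists\tau\in T)(\sigma\subseteq\tau\ \wedge\ \tau(n)=i)$. On $2^\omega$, $+$ is coordinatewise addition modulo $2$, and $A+B=\{a+b:a\in A,\ b\in B\}$ for $A,B\subseteq 2^\omega$; for $n=0$ the displayed set is read as $F$ itself. *)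

(* Defs.v *)
From HB Require Import structures.
From mathcomp Require Import all_boot all_order all_algebra.
From mathcomp Require Import all_classical all_reals all_analysis.

Set Implicit Arguments.
Unset Strict Implicit.
Unset Printing Implicit Defensive.
Import Order.TTheory GRing.Theory Num.Theory.
Import numFieldNormedType.Exports.
Local Open Scope classical_set_scope.
Local Open Scope ring_scope.

Definition agree (n : nat) (x y : cantor_space) : Prop :=
  forall i, (i < n)%N -> x i = y i.

Lemma agree_trans n x y z : agree n x y -> agree n y z -> agree n x z.
Proof. by move=> xy yz i ni; rewrite (xy i ni); exact: yz. Qed.

Lemma agree_le m n x y : (m <= n)%N -> agree n x y -> agree m x y.
Proof. by move=> mn xy i im; apply: xy; exact: leq_trans mn. Qed.

Lemma nbhs_agree (x : cantor_space) (A : set cantor_space) :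
  nbhs x A -> exists n, forall y, agree n x y -> A y.
Proof.
pose F : set_system cantor_space := filter_from [set: nat] (fun n => agree n x).
have FF : Filter F.
  apply: filter_from_filter; first by exists 0%N.
  move=> i j _ _; exists (maxn i j) => // y xy.
  by split; apply: agree_le xy; rewrite ?leq_maxl ?leq_maxr.
have : F --> x.
  apply/cvg_sup => i U [V] [[W] oW <-] Wx VU.
  apply: (filterS VU); exists i.+1 => // y xy.
  by rewrite /= -xy.
by move=> + xA => /(_ A xA) [n _ nA]; exists n.
Qed.

Lemma open_agree n x : open [set y | agree n x y].
Proof.
elim: n => [|n IH].
  by rewrite (_ : mkset _ = setT); [exact: openT|apply/seteqP; split].
rewrite (_ : mkset _ = [set y | agree n x y] `&`
    (@proj nat (fun=> bool) n @^-1` [set x n])); last first.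
  apply/seteqP; split => y /=.
    by move=> xy; split; [exact: agree_le xy | rewrite /proj -(xy n)].
  move=> [xy yn] i; rewrite ltnS leq_eqVlt => /predU1P[->|/xy//].
  by rewrite -yn.
apply: openI => //; apply: open_comp; last exact: discrete_open.
by move=> ? _; exact: proj_continuous.
Qed.

Lemma clopen_agree n x : clopen [set y | agree n x y].
Proof.
split; first exact: open_agree.
rewrite -openC openE => y /= nxy; rewrite /interior.
apply: (@filterS _ (nbhs y) _ [set z | agree n y z]).
  move=> z /= yz xz; apply: nxy; apply: agree_trans xz _ => i ni.
  by rewrite yz.
by apply: open_nbhs_nbhs; split; [exact: open_agree|].
Qed.

Lemma nbhs_agree_self n (x : cantor_space) : nbhs x [set y | agree n x y].
Proof. by apply: open_nbhs_nbhs; split; [exact: open_agree|]. Qed.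

Lemma clopen_finite_depth (A : set cantor_space) : clopen A ->
  exists n, forall x y, agree n x y -> A x -> A y.
Proof.
move=> [oA cA]; have := cantor_space_compact.
move/compact_near_coveringP => /(_ nat \oo
  (fun n x => forall y, agree n x y -> A x -> A y) _) => -[|N _ AN].
- move=> x _; have [Ax|nAx] := pselect (A x).
    have /nbhs_agree[m mA] : nbhs x A by apply: open_nbhs_nbhs.
    exists ([set z | agree m x z], [set n | (m <= n)%N]).
      by split; [exact: nbhs_agree_self | exists m].
    move=> [z n] /= [xz mn] y zy _; apply: mA.
    by apply: agree_trans xz _; exact: agree_le zy.
  exists (~` A, setT).
    by split; [apply: open_nbhs_nbhs; split => //; exact: closed_openC
              |exact: filterT].
  by move=> [z n] /= [nAz _] y _ /nAz.
- by exists N => x y xy; apply: (AN N (leqnn N) x I y xy).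
Qed.

Definition pad0 (s : seq bool) : cantor_space := fun i => nth false s i.

Section clopen_weight.
Context {R : realType}.

(* Proportion of binary strings of length [n] whose extension by zeros lies
   in [A]. *)
Definition density (A : set cantor_space) (n : nat) : R :=
  #|[set t : n.-tuple bool | `[< A (pad0 t) >]]%SET|%:R / 2 ^+ n.

(* For clopen [A] the sequence [density A] is eventually constant, since
   membership in [A] depends on finitely many coordinates only. *)
Definition clopen_weight (A : set cantor_space) : \bar R :=
  (limn (density A))%:E.

Lemma pad0_rcons n (t : n.-tuple bool) b : agree n (pad0 t) (pad0 (rcons t b)).
Proof. by move=> i ni; rewrite /pad0 nth_rcons size_tuple ni. Qed.

Lemma agree_sym n x y : agree n x y -> agree n y x.
Proof. by move=> xy i ni; rewrite xy. Qed.

Lemma density_step (A : set cantor_space) n :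
  (forall x y, agree n x y -> A x -> A y) -> density A n.+1 = density A n.
Proof.
move=> An.
pose f b (t : n.-tuple bool) : n.+1.-tuple bool := [tuple of rcons t b].
pose S := [set t : n.-tuple bool | `[< A (pad0 t) >]]%SET.
have f_inj b : injective (f b).
  by move=> s t /(congr1 val) /= /rcons_inj[] /val_inj.
rewrite /density (_ : finset _ = (f false @: S :|: f true @: S)%SET); last first.
  apply/setP => t; rewrite !inE; apply/asboolP/orP => [At|].
    case/tupleP: t At => b0 t0.
    have [s [b stb]] : exists s : n.-tuple bool, exists b,
        [tuple of b0 :: t0] = f b s.
      have sz : size (belast b0 t0) == n by rewrite size_belast size_tuple.
      exists (Tuple sz), (last b0 t0); apply: val_inj => /=.
      by rewrite -lastI.
    move=> At; have As : s \in S.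
      rewrite inE; apply/asboolP.
      apply: An (agree_sym (pad0_rcons s b)) _.
      by move: At; rewrite stb.
    rewrite stb; case: b {stb} => //; [right|left]; exact: imset_f.
  by case=> /imsetP[s]; rewrite inE => /asboolP As ->;
    apply: An As; exact: pad0_rcons.
rewrite cardsU (_ : (_ :&: _)%SET = finset.set0); last first.
  apply/setP => t; rewrite !inE; apply/negP => /andP[/imsetP[s _ ->]].
  by move=> /imsetP[s' _] /(congr1 val) /= /rcons_inj[].
rewrite cards0 subn0 !card_imset//.
rewrite addnn -muln2 natrM exprSr invfM mulrACA divff ?mulr1//.
Qed.

Lemma density_eventually (A : set cantor_space) n m :
  (forall x y, agree n x y -> A x -> A y) -> (n <= m)%N ->
  density A m = density A n.
Proof.
move=> An /subnK <-; elim: (m - n)%N => // k IH.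
rewrite addSn density_step// => x y xy; apply: An.
by apply: agree_le xy; exact: leq_addl.
Qed.

Lemma cvg_density_eventually (A : set cantor_space) n :
  (forall x y, agree n x y -> A x -> A y) -> density A @ \oo --> density A n.
Proof.
move=> An; apply: cvg_near_cst.
by exists n => // m /= nm; exact: density_eventually.
Qed.

Lemma cvg_density (A : set cantor_space) : clopen A -> cvgn (density A).
Proof.
move=> /clopen_finite_depth[n An]; apply/cvg_ex; exists (density A n).
exact: cvg_density_eventually.
Qed.

Lemma clopen_weight_depth (A : set cantor_space) n :
  (forall x y, agree n x y -> A x -> A y) ->
  clopen_weight A = (density A n)%:E.
Proof.
by move=> An; rewrite /clopen_weight (cvg_lim _ (cvg_density_eventually An)).
Qed.

Lemma density_ge0 (A : set cantor_space) n : 0 <= density A n.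
Proof. by rewrite divr_ge0. Qed.

Lemma clopen_weight_ge0 (A : set cantor_space) : (0 <= clopen_weight A)%E.
Proof.
rewrite lee_fin; have [cA|/dvgP ->//] := pselect (cvgn (density A)).
by apply: limr_ge => //; apply: nearW => n; exact: density_ge0.
Qed.

Lemma density0 n : density set0 n = 0.
Proof.
rewrite /density (_ : finset _ = finset.set0) ?cards0 ?mul0r//.
by apply/setP => t; rewrite !inE; apply/asboolP.
Qed.

Lemma clopen_weight0 : clopen_weight set0 = 0%E.
Proof. by rewrite (@clopen_weight_depth _ 0%N)// density0. Qed.

Lemma densityU (A B : set cantor_space) n : A `&` B = set0 ->
  density (A `|` B) n = density A n + density B n.
Proof.
move=> AB; rewrite /density -mulrDl -natrD -cardsUI.
rewrite [X in (_ + #|pred_of_set X|)%N](_ : _ = finset.set0) ?cards0 ?addn0.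
  congr (#|pred_of_set _|%:R / _); apply/setP => t; rewrite !inE.
  by rewrite asbool_or.
apply/setP => t; rewrite !inE -asbool_and; apply/asboolP => ABt.
by have : (A `&` B) (pad0 t) by []; rewrite AB.
Qed.

Lemma clopen_weightU (A B : set cantor_space) : clopen A -> clopen B ->
  A `&` B = set0 ->
  clopen_weight (A `|` B) = (clopen_weight A + clopen_weight B)%E.
Proof.
move=> cA cB AB; rewrite /clopen_weight -EFinD; congr EFin.
rewrite (_ : density (A `|` B) = density A \+ density B).
  by apply: cvg_lim => //; apply: cvgD; exact: cvg_density.
by apply/funext => n; exact: densityU.
Qed.

End clopen_weight.

Definition clopen_type : Type := cantor_space.
HB.instance Definition _ := Pointed.on clopen_type.

Definition clopen_display : measure_display. Proof. exact. Qed.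

Definition clopen_sets : set (set clopen_type) := @clopen cantor_space.

Lemma clopen_setsC : setC_closed clopen_sets.
Proof. by move=> A cA; exact: clopenC. Qed.

HB.instance Definition _ := @isAlgebraOfSets.Build clopen_display clopen_type
  clopen_sets clopen0 clopenU clopen_setsC.

(* By compactness a disjoint sequence of clopen sets with clopen union is
   eventually empty, so that finite additivity is all that is needed. *)
Lemma clopen_trivIset_eventually0 (F : (set cantor_space)^nat) :
  (forall i, clopen (F i)) -> trivIset setT F -> clopen (\bigcup_i F i) ->
  exists N, forall k, (N <= k)%N -> F k = set0.
Proof.
move=> cF tF [_ cU].
have := subclosed_compact cU cantor_space_compact (@subsetT _ _).
move/compact_near_coveringP => /(_ nat \oo
  (fun n x => forall k, (n <= k)%N -> ~ F k x) _) => -[|N _ AN].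
- move=> x [i _ Fix].
  exists (F i, [set n | (i < n)%N]).
    split; last by exists i.+1.
    by apply: open_nbhs_nbhs; split => //; case: (cF i).
  move=> [z n] /= [Fiz ni] k nk Fkz.
  have := tF i k I I (ex_intro _ z (conj Fiz Fkz)) => ik.
  by move: (leq_trans ni nk); rewrite ik ltnn.
- exists N => k Nk; rewrite -subset0 => x Fkx.
  by apply: (AN N (leqnn N) x _ k Nk Fkx); exists k.
Qed.

Section haar.
Context {R : realType}.

Let weight : set clopen_type -> \bar R := @clopen_weight R.

Lemma clopen_weight_bigU (F : (set cantor_space)^nat) n :
  (forall i, clopen (F i)) -> trivIset setT F ->
  clopen (\big[setU/set0]_(i < n) F i) /\
  clopen_weight (\big[setU/set0]_(i < n) F i) =
    (\sum_(0 <= i < n) clopen_weight (F i) : \bar R)%E.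
Proof.
move=> cF tF; elim: n => [|n [cn IH]].
  by rewrite big_ord0 big_nil clopen_weight0; split => //; exact: clopen0.
rewrite big_ord_recr big_nat_recr//= -IH; split; first exact: clopenU.
apply: clopen_weightU => //.
rewrite -subset0 -bigcup_mkord => x [[k /= kn Fkx] Fnx].
have := tF k n I I (ex_intro _ x (conj Fkx Fnx)) => kE.
by move: kn; rewrite kE ltnn.
Qed.

Lemma clopen_weight_additive : semi_sigma_additive weight.
Proof.
move=> F cF tF cU.
have [N FN] := clopen_trivIset_eventually0 cF tF cU.
apply: cvg_near_cst; exists N => // n /= Nn.
have [_ <-] := clopen_weight_bigU n cF tF.
congr clopen_weight; apply/seteqP; split => [x|x [k _ Fkx]].
  by rewrite -bigcup_mkord => -[k _ Fkx]; exists k.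
rewrite -bigcup_mkord; exists k => //=; rewrite ltnNge; apply/negP => nk.
by move: Fkx; rewrite FN// (leq_trans Nn).
Qed.

HB.instance Definition _ := isMeasure.Build _ _ R weight
  clopen_weight0 (@clopen_weight_ge0 R) clopen_weight_additive.

(* [haar_cylinder] below identifies this as the product of the uniform
   measures on [bool]. *)
Definition haar := measure_extension weight.

HB.instance Definition _ := Measure.on haar.

Lemma haar_cylinder (x : cantor_space) n :
  haar [set y | agree n x y] = (2 ^- n)%:E.
Proof.
rewrite /haar /measure_extension measurable_mu_extE/=; last exact: clopen_agree.
rewrite /weight (@clopen_weight_depth _ _ n); last first.
  by move=> y z yz xy; exact: agree_trans yz.
rewrite /density (_ : finset _ = [set [tuple x i | i < n]]%SET).
  by rewrite cards1 mul1r.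
apply/setP => t; rewrite !inE; apply/asboolP/eqP => [xt|->].
  apply: eq_from_tnth => i; rewrite tnth_mktuple xt//.
  by rewrite (tnth_nth false).
move=> i ni; rewrite /pad0 -[i]/(val (Ordinal ni)) -tnth_nth.
by rewrite tnth_mktuple.
Qed.

Lemma haar_setT : haar setT = 1%E.
Proof.
rewrite (_ : setT = [set y | agree 0 point y]).
  by rewrite haar_cylinder expr0 invr1.
by apply/seteqP; split.
Qed.

HB.instance Definition _ :=
  @Measure_isProbability.Build _ _ _ haar haar_setT.

End haar.
Arguments haar R : clear implicits.

Lemma closed_haar_measurable (C : set cantor_space) : closed C ->
  clopen_sets.-sigma.-measurable C.
Proof.
move=> cC.
pose D n : set cantor_space := [set y | exists2 x, C x & agree n x y].
have DE : C = \bigcap_n D n.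
  apply/seteqP; split => [x Cx n _|x Dx]; first by exists x.
  apply: contrapT => nCx.
  have /nbhs_agree[n nA] : nbhs x (~` C).
    by apply: open_nbhs_nbhs; split => //; exact: closed_openC.
  by have [y Cy yx] := Dx n I; apply: (nA y) Cy; exact: agree_sym.
rewrite DE; apply: bigcapT_measurable => n; apply: sub_sigma_algebra.
have oD m (B : set cantor_space) :
    (forall x y, agree m x y -> B x -> B y) -> open B.
  move=> Bm; rewrite openE => x Bx; rewrite /interior.
  by apply: filterS (nbhs_agree_self m x) => y xy; exact: Bm xy Bx.
have Dn x y : agree n x y -> D n x -> D n y.
  by move=> xy [z Cz zx]; exists z => //; exact: agree_trans xy.
split; first exact: oD Dn.
rewrite -openC; apply: (oD n) => x y xy nDx Dy.
by apply/nDx/(Dn _ _ _ Dy)/agree_sym.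
Qed.

Definition ideal_E (R : realType) : set (set cantor_space) :=
  [set E | exists C : (set cantor_space)^nat,
    (forall k, closed (C k) /\ haar R (C k) = 0%E) /\ E `<=` \bigcup_k C k].

Definition is_tree (T : set (seq bool)) : Prop :=
  T !=set0 /\ forall s t, prefix s t -> T t -> T s.

Definition body (T : set (seq bool)) : set cantor_space :=
  [set x | forall n, T (mkseq x n)].

(* [onth t n = Some i] includes the requirement [n < size t]. *)
Definition splitting_tree (T : set (seq bool)) : Prop :=
  is_tree T /\
  forall s, T s -> exists N, forall n, (N < n)%N -> forall i : bool,
    exists t, [/\ T t, prefix s t & onth t n = Some i].

(* [addb] is addition modulo 2. *)
Definition cantor_add (x y : cantor_space) : cantor_space :=
  fun n => x n (+) y n.

Definition sumset (A B : set cantor_space) : set cantor_space :=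
  [set cantor_add a b | a in A & b in B].

(* [sumset_iter F A n] is [F + A + ... + A] with [n] summands [A]. *)
Definition sumset_iter (F A : set cantor_space) (n : nat) : set cantor_space :=
  iter n (fun B => sumset B A) F.

(* Main.v *)
Require Import Defs.
From mathcomp Require Import all_boot all_order all_algebra.
From mathcomp Require Import all_classical all_reals all_analysis.

Set Implicit Arguments.
Unset Strict Implicit.
Unset Printing Implicit Defensive.
Import Order.TTheory GRing.Theory Num.Theory.
Import numFieldNormedType.Exports.
Local Open Scope classical_set_scope.
Local Open Scope ring_scope.

(** Cut [nat] into consecutive finite blocks and let [T] consist of the finite
    strings that are constant on each block.  It is a splitting tree: once a
    string ends, every later block is free to carry either constant.  Its body
    lies in the set [G] of all block-constant sequences, which is a subgroup of
    Cantor space, so that [F + [T] + ... + [T]] never leaves [F + G], however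
    many summands there are.  It remains to make [F + G] small.

    Let [F] be covered by closed null sets [C j], and let [a k] be the end of
    the block number [k].  Up to [a k] there are at most [2 ^ k.+1]
    block-constant strings, so [C j + G] has at most [2 ^ k.+1] times as many
    restrictions to [a k] as [C j] has ([card_restrictions_sumset],
    [card_restrictions_block_constant]).  A closed null set is the decreasing
    intersection of its clopen approximations, hence the proportion of strings
    of length [n] that are restrictions of its points tends to [0]
    ([null_few_restrictions]).  As nothing bounds the block lengths, [a k] can
    be taken so large that this proportion is at most [4 ^- k] for each of
    [C 0], ..., [C k] ([exists_blocks]).  Then the proportion for [C j + G] is
    at most [2 * 2 ^- k] for all [k >= j], and the closure of [C j + G] is
    null ([haar_closure_sumset_block_constant]). *)

(** * Clopen approximations and restrictions *)

(** The union of the cylinders of depth [n] that meet [A]. *)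
Definition hull (n : nat) (A : set cantor_space) : set cantor_space :=
  [set y | exists2 x, A x & agree n x y].

Lemma hull_depth n A x y : agree n x y -> hull n A x -> hull n A y.
Proof. by move=> xy [z Az zx]; exists z => //; exact: agree_trans xy. Qed.

Lemma hull_le m n A : (m <= n)%N -> hull n A `<=` hull m A.
Proof. by move=> mn y [x Ax xy]; exists x => //; exact: agree_le xy. Qed.

Lemma clopen_depth n (A : set cantor_space) :
  (forall x y, agree n x y -> A x -> A y) -> clopen A.
Proof.
move=> An.
have op (B : set cantor_space) :
    (forall x y, agree n x y -> B x -> B y) -> open B.
  move=> Bn; rewrite openE => x Bx; rewrite /interior.
  by apply: filterS (nbhs_agree_self n x) => y xy; exact: Bn xy Bx.
split; first exact: op.
rewrite -openC; apply: op => x y xy nAx Ay; apply: nAx.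
exact: An (agree_sym xy) Ay.
Qed.

Lemma clopen_hull n A : clopen (hull n A).
Proof. by apply: (@clopen_depth n) => x y; exact: hull_depth. Qed.

Lemma subset_hull n A : A `<=` hull n A.
Proof. by move=> x Ax; exists x. Qed.

(** Measures are estimated on closures, because the ideal asks for closed
    covers while a sumset need not be closed; passing to the closure costs
    nothing, since clopen approximations contain it. *)
Lemma closure_hull n A : closure A `<=` hull n A.
Proof.
by have [_ /closure_id ->] := clopen_hull n A; apply: closureS;
  exact: subset_hull.
Qed.

Lemma bigcap_hull (C : set cantor_space) :
  closed C -> \bigcap_n hull n C = C.
Proof.
move=> cC; apply/seteqP; split => [x hx|x Cx n _]; last exact: subset_hull.
apply: cC => B /nbhs_agree[n nB]; have [y Cy yx] := hx n I.
by exists y; split => //; apply: nB => i /yx.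
Qed.


Definition restr (n : nat) (x : cantor_space) : n.-tuple bool :=
  [tuple x i | i < n].

Definition restrictions (n : nat) (A : set cantor_space) :
    {set n.-tuple bool} :=
  [set t | `[< exists2 x, A x & restr n x = t >]]%SET.

Lemma restrP n x (t : n.-tuple bool) : restr n x = t <-> agree n x (pad0 t).
Proof.
split=> [<- i ni|xt].
  by rewrite /pad0 -[i]/(val (Ordinal ni)) -tnth_nth tnth_mktuple.
by apply: eq_from_tnth => i; rewrite tnth_mktuple xt// (tnth_nth false).
Qed.

Lemma haar_hull (R : realType) n A :
  haar R (hull n A) = (#|restrictions n A|%:R / 2 ^+ n)%:E.
Proof.
rewrite /haar /measure_extension measurable_mu_extE/=; last exact: clopen_hull.
rewrite (@clopen_weight_depth _ _ n); last by move=> x y; exact: hull_depth.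
congr (#|pred_of_set _|%:R / _)%:E; apply/setP => t; rewrite !inE.
apply: asbool_equiv_eq.
by split=> -[x Ax xt]; exists x => //; apply/restrP.
Qed.

Lemma measurable_hull n A : clopen_sets.-sigma.-measurable (hull n A).
Proof. by apply: sub_sigma_algebra; exact: clopen_hull. Qed.

Lemma haar_closure_le (R : realType) n A :
  (haar R (closure A) <= (#|restrictions n A|%:R / 2 ^+ n)%:E)%E.
Proof.
rewrite -haar_hull; apply: le_measure; rewrite ?inE.
- by apply: closed_haar_measurable; exact: closed_closure.
- exact: measurable_hull.
- exact: closure_hull.
Qed.

(** Continuity from above, along the clopen approximations of [C]; these
    intersect in [C] because [C] is closed. *)
Lemma null_few_restrictions (R : realType) (C : set cantor_space) (e : R) :
  closed C -> haar R C = 0%E -> 0 < e ->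
  exists N, forall n, (N <= n)%N -> #|restrictions n C|%:R <= e * 2 ^+ n.
Proof.
move=> cC C0 e0.
have : haar R \o (fun n => hull n C) @ \oo --> haar R (\bigcap_n hull n C).
  apply: nonincreasing_cvg_mu.
  - change (haar R (hull 0 C) < +oo)%E; rewrite haar_hull; exact: ltry.
  - by move=> n; exact: measurable_hull.
  - by rewrite bigcap_hull//; exact: closed_haar_measurable.
  - by move=> m n mn; apply/subsetPset; exact: hull_le.
rewrite bigcap_hull// C0 => /fine_cvgP[_] /cvgr0_norm_lt /(_ _ e0) [N _ Ne].
exists N => n Nn; have := ltW (Ne n Nn).
by rewrite /= haar_hull /= ger0_norm ?divr_ge0// ler_pdivrMr// exprn_gt0.
Qed.

Lemma card_restrictions_sumset n A B :
  (#|restrictions n (sumset A B)| <=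
   #|restrictions n A| * #|restrictions n B|)%N.
Proof.
pose add (s t : n.-tuple bool) := [tuple tnth s i (+) tnth t i | i < n].
rewrite -cardsX; apply: leq_trans (leq_imset_card (uncurry add) _).
apply: subset_leq_card; apply/fintype.subsetP => t; rewrite inE => /asboolP.
move=> [_ [a Aa [b Bb <-]] <-]; apply/imsetP; exists (restr n a, restr n b).
  by rewrite !inE/=; apply/andP; split; apply/asboolP; [exists a|exists b].
by apply: eq_from_tnth => i; rewrite /= !tnth_mktuple.
Qed.

(** * Block-constant sequences *)

(** The blocks are the fibres of [blk], the function that numbers them. *)
Definition block_constant (blk : nat -> nat) : set cantor_space :=
  [set x | exists b : nat -> bool, x = b \o blk].

Lemma card_restrictions_block_constant blk n k :
  (forall i, (i < n)%N -> (blk i < k)%N) ->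
  (#|restrictions n (block_constant blk)| <= 2 ^ k)%N.
Proof.
move=> blk_lt.
pose f (b : k.-tuple bool) := restr n (fun i => nth false b (blk i)).
rewrite -card_bool -card_tuple -cardsT.
apply: leq_trans (leq_imset_card f _).
apply: subset_leq_card; apply/fintype.subsetP => t; rewrite inE => /asboolP.
move=> [_ [b ->] <-]; apply/imsetP; exists [tuple b c | c < k] => //.
apply: eq_from_tnth => i; rewrite !tnth_mktuple.
pose c := Ordinal (blk_lt _ (ltn_ord i)).
by have := tnth_nth false [tuple b c | c < k] c; rewrite tnth_mktuple.
Qed.

(** Block-constant sequences form a group under [cantor_add]: a sum of any
    number of them is again one of them. *)
Lemma sumset_iter_block_constant blk F A n : A `<=` block_constant blk ->
  sumset_iter F A n `<=` sumset F (block_constant blk).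
Proof.
move=> AG; elim: n => [x Fx|n IH _
    [y /IH[a Fa [_ [b ->] <-]] [z /AG[c ->] <-]]].
  exists x => //; exists (fun=> false); first by exists (fun=> false).
  by apply/funext => i; exact: addbF.
exists a => //; exists ((fun i => b i (+) c i) \o blk).
  by exists (fun i => b i (+) c i).
by apply/funext => i; exact: addbA.
Qed.

(** * The tree of block-constant strings *)

Definition block_tree (blk : nat -> nat) : set (seq bool) :=
  [set s | exists b : nat -> bool, s = mkseq (b \o blk) (size s)].

Lemma block_tree_mkseq blk b n : block_tree blk (mkseq (b \o blk) n).
Proof. by exists b; rewrite size_mkseq. Qed.

Lemma take_mkseq (T : Type) (f : nat -> T) m n : (m <= n)%N ->
  take m (mkseq f n) = mkseq f m.
Proof. by move=> mn; rewrite /mkseq -map_take take_iota (minn_idPl mn). Qed.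

(** A position whose block is numbered higher than every block met by [s] can
    be given either value: changing the constant of that block leaves [s]
    untouched. *)
Lemma block_tree_splitting blk :
  (forall c, exists N, forall n, (N <= n)%N -> (c < blk n)%N) ->
  splitting_tree (block_tree blk).
Proof.
move=> blk_oo; split.
  split; first by exists [::]; exact: (block_tree_mkseq blk (fun=> false) 0).
  move=> s t st [b tE]; exists b.
  by move: (st); rewrite prefixE tE take_mkseq ?size_prefix// => /eqP.
move=> s [b sE].
have [N Nblk] := blk_oo (\max_(i < size s) blk i)%N.
exists (maxn N (size s)) => n; rewrite gtn_max => /andP[Nn sn] i.
have fresh j : (j < size s)%N -> blk j != blk n.
  move=> js; rewrite neq_ltn (leq_ltn_trans _ (Nblk n (ltnW Nn)))//.
  exact: (leq_bigmax (Ordinal js)).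
pose b' c := if c == blk n then i else b c.
exists (mkseq (b' \o blk) n.+1); split; first exact: block_tree_mkseq.
  rewrite prefixE take_mkseq; last exact: leqW (ltnW sn).
  apply/eqP/esym; apply: (etrans sE); apply/eq_in_map => j.
  by rewrite mem_iota /b' /= => /fresh/negbTE->.
by rewrite onthE (nth_map false) ?size_mkseq// nth_mkseq//= /b' eqxx.
Qed.

Lemma body_block_tree blk : body (block_tree blk) `<=` block_constant blk.
Proof.
move=> x Tx.
have x_blk i j : blk i = blk j -> x i = x j.
  move=> ij; have [b] := Tx (maxn i j).+1; rewrite size_mkseq => xb.
  have xE l : (l <= maxn i j)%N -> x l = b (blk l).
    by move=> lm; have := congr1 (nth false ^~ l) xb; rewrite /= !nth_mkseq.
  by rewrite !xE ?ij// ?leq_maxl ?leq_maxr.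
exists (fun c => `[< exists2 i, blk i = c & x i >]); apply/funext => i /=.
apply/idP/asboolP => [xi|[j ji]]; first by exists i.
by rewrite (x_blk _ _ ji).
Qed.

(** * The choice of the blocks *)

(** [a k] is the end of the block number [k], and [m j k] prescribes how far
    the blocks [0], ..., [k] must reach for the sake of the [j]-th requirement;
    only the requirements [j <= k] can be honoured, as there are infinitely
    many. *)
Lemma exists_blocks (m : nat -> nat -> nat) :
  exists (blk : nat -> nat) (a : nat -> nat),
    [/\ forall c, exists N, forall n, (N <= n)%N -> (c < blk n)%N,
        forall k i, (i < a k)%N -> (blk i <= k)%N &
        forall j k, (j <= k)%N -> (m j k <= a k)%N].
Proof.
(* The summand 1 keeps every block nonempty. *)
pose a k := (\sum_(l < k.+1) (1 + \sum_(j < l.+1) m j l))%N.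
have a_mono : {homo a : k l / (k <= l)%N}.
  apply: (homo_leq leqnn leq_trans) => k.
  by rewrite /a [leqRHS]big_ord_recr leq_addr.
have a_gt k : (k < a k)%N.
  elim: k => [|k IH]; first by rewrite /a big_ord_recr /= big_ord0.
  by rewrite /a big_ord_recr /= addnA addn1 ltnS ltn_addr.
have ex i : exists k, (i < a k)%N by exists i.
exists (fun i => ex_minn (ex i)), a; split.
- move=> c; exists (a c) => n acn; case: ex_minnP => k nk _.
  rewrite ltnNge; apply/negP => /a_mono akc.
  by have := leq_trans nk (leq_trans akc acn); rewrite ltnn.
- by move=> k i ik; case: ex_minnP => l _; exact.
- move=> j k jk; have jk' : (j < k.+1)%N by [].
  rewrite /a big_ord_recr /= [X in (_ + (_ + X))%N](bigD1 (Ordinal jk'))//=.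
  by rewrite addnA addnCA; exact: leq_addr.
Qed.

(** The factor [2 ^ k.+1], which counts block-constant strings, is absorbed by
    the density [4 ^- k] of [C] at the ends of the blocks. *)
Lemma haar_closure_sumset_block_constant (R : realType) blk (a : nat -> nat)
    (C : set cantor_space) (K : nat) :
  (forall k i, (i < a k)%N -> (blk i <= k)%N) ->
  (forall k, (K <= k)%N ->
     #|restrictions (a k) C|%:R <= (4 ^- k : R) * 2 ^+ a k) ->
  haar R (closure (sumset C (block_constant blk))) = 0%E.
Proof.
move=> a_blk small; apply/eqP; rewrite eq_le measure_ge0 andbT.
have le k : (K <= k)%N ->
    (haar R (closure (sumset C (block_constant blk))) <= (2 * 2^-1 ^+ k)%:E)%E.
  move=> Kk; apply: le_trans (haar_closure_le R (a k) _) _.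
  rewrite lee_fin ler_pdivrMr ?exprn_gt0//.
  apply: (@le_trans _ _ (#|restrictions (a k) C|%:R * (2 ^ k.+1)%:R)).
    rewrite -natrM ler_nat (leq_trans (card_restrictions_sumset _ _ _))//.
    rewrite leq_mul2l card_restrictions_block_constant ?orbT// => i.
    exact: a_blk.
  apply: (@le_trans _ _ (4 ^- k * 2 ^+ a k * (2 ^ k.+1)%:R)).
    by rewrite ler_wpM2r// small.
  rewrite mulrAC ler_wpM2r ?exprn_ge0// natrX (natrM _ 2 2 : 4 = 2 * 2 :> R).
  by rewrite exprMn invfM exprS mulrCA -!mulrA mulVf ?expf_neq0// mulr1 exprVn.
have : (fun k => (2 * 2^-1 ^+ k : R)%:E) @ \oo --> 0%E.
  apply/fine_cvgP; split; first exact: nearW.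
  apply: (@cvg_geometric R); rewrite ger0_norm ?invr_ge0// invf_lt1//.
  by rewrite ltr1n.
move=> cv0; rewrite -(cvg_lim _ cv0)//; apply: lime_ge.
  by apply/cvg_ex; exists 0%E.
by exists K => // k /= /le.
Qed.

Theorem theorem22 (R : realType) (F : set cantor_space) :
  ideal_E R F ->
  exists T : set (seq bool),
    splitting_tree T /\ forall n : nat, ideal_E R (sumset_iter F (body T) n).
Proof.
move=> [C [C0 FC]].
have /choice[m mP] (p : nat * nat) : exists N, forall n, (N <= n)%N ->
    #|restrictions n (C p.1)|%:R <= (4 ^- p.2 : R) * 2 ^+ n.
  have [cCp Cp0] := C0 p.1.
  by apply: null_few_restrictions => //; rewrite invr_gt0 exprn_gt0.
have [blk [a [blk_oo a_blk ma]]] := exists_blocks (fun j k => m (j, k)).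
exists (block_tree blk); split; first exact: block_tree_splitting.
move=> n; exists (fun j => closure (sumset (C j) (block_constant blk))); split.
  move=> j; split; first exact: closed_closure.
  apply: (@haar_closure_sumset_block_constant R blk a (C j) j) => // k jk.
  exact: (mP (j, k)) (ma j k jk).
apply: subset_trans (sumset_iter_block_constant (@body_block_tree blk)) _.
move=> _ [x /FC[j _ Cjx] [y Gy <-]]; exists j => //.
by apply: subset_closure; exists x => //; exists y.
Qed.
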